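(* Let $K\subseteq\mathbb{R}^n$ be a convex body and let $\Lambda\subseteq\mathbb{R}^n$ be an $n$-dimensional lattice. Then $$\#(K\cap\Lambda)\le\prod_{i=1}^n\left\lfloor\frac{1}{\rho_i(K,\Lambda)}+1\right\rfloor,$$ and this inequality cannot be improved in general, in the sense that there are $K$ and $\Lambda$ for which equality holds.
   Context: A convex body in $\mathbb{R}^n$ is a compact convex set with non-empty interior. An $n$-dimensional lattice is a set $\Lambda=B\mathbb{Z}^n$ with $B\in\mathbb{R}^{n\times n}$ invertible. $\#$ denotes cardinality. $K_c=K-K=\{x-y:x,y\in K\}$ is the difference body. Packing minima: for $1\le i\le n$, $\rho_i(K,\Lambda)=\inf\{\rho>0:(\rho K_c+L)\cap\Lambda\neq L\cap\Lambda\text{ for all }(n-i)\text{-dimensional linear subspaces }L\subseteq\mathbb{R}^n\}$. Equivalently, $\rho_i(K,\Lambda)=\max\lambda_1(K_c|L^\perp,\Lambda|L^\perp)$, the maximum over all $(n-i)$-dimensional linear lattice planes $L$ of $\Lambda$ (linear subspaces $L$ with $\dim L=\dim(L\cap\Lambda)=n-i$), where $\cdot|L^\perp$ is orthogonal projection onto $L^\perp$ and, for an origin-symmetric convex body $M$ and a lattice $\Gamma$ in the same Euclidean space, $\lambda_1(M,\Gamma)=\min\{\lambda>0:\lambda M\cap\Gamma\ne\{0\}\}$. *)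

(* Defs.v *)
From mathcomp Require Import all_boot all_order all_algebra finmap.
From mathcomp Require Import all_classical all_reals all_analysis.

Set Implicit Arguments.
Unset Strict Implicit.
Unset Printing Implicit Defensive.

Import Order.TTheory GRing.Theory Num.Theory.
Import numFieldNormedType.Exports.

Local Open Scope classical_set_scope.
Local Open Scope ring_scope.

(* R^n is 'cV[R]_n with the topology of the max norm, i.e. the usual one. *)

Definition convex_body (R : realType) (n : nat) (K : set 'cV[R]_n) : Prop :=
  [/\ compact K, convex_set K & K° !=set0].

Definition lattice_of (R : realType) (n : nat) (B : 'M[R]_n) : set 'cV[R]_n :=
  [set B *m map_mx intr z | z in [set: 'cV[int]_n]].

Definition is_lattice (R : realType) (n : nat) (Lam : set 'cV[R]_n) : Prop :=
  exists2 B : 'M[R]_n, B \in unitmx & Lam = lattice_of B.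

Definition difference_body (R : realType) (n : nat) (K : set 'cV[R]_n) :
    set 'cV[R]_n :=
  [set x - y | x in K & y in K].

Definition thickening (R : realType) (n : nat) (K : set 'cV[R]_n) (rho : R)
    (L : {vspace 'cV[R]_n}) : set 'cV[R]_n :=
  [set rho *: x + y | x in difference_body K & y in [set` L]].

(* [inf] is real-valued, with value 0 on the empty set; for a convex body,
   a lattice and 1 <= i <= n the set below is nonempty and bounded below by 0. *)
Definition packing_min (R : realType) (n : nat) (K Lam : set 'cV[R]_n)
    (i : nat) : R :=
  inf [set rho : R | 0 < rho /\
    forall L : {vspace 'cV[R]_n}, \dim L = (n - i)%N ->
      thickening K rho L `&` Lam <> [set` L] `&` Lam].

(* Main.v *)
(* Put a_i = floor (1 / rho_i + 1), so that 1 / a_i < rho_i. By definition of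
   rho_i there is a subspace L_i of dimension n - i such that w \in L_i whenever
   w is a lattice point of (1 / a_i) K_c + L_i. Hence, for x, y \in K and both
   lattice points, x - y \in a_i Lam + L_i forces x - y \in L_i. The rho_i need
   not be monotone and the L_i need not be nested; this is circumvented by
   choosing i with a_i minimal. Reducing the coordinates of Lam / (Lam :&: L_i)
   modulo a_i separates the cosets of L_i met by K, so these number at most
   a_i ^ c with c the codimension of the span of Lam :&: L_i; this is at most the
   product of the a_j with j <= c. Inside one coset the same argument applies to
   Lam :&: L_i and the subspaces L_j :&: L_i with j > c. Equality holds for the
   unit cube and the integer lattice: there rho_i >= 1, so the product is at most
   2 ^ n, the number of vertices. *)
Require Import Defs.
From mathcomp Require Import all_boot all_order all_algebra finmap.
From mathcomp Require Import all_classical all_reals all_analysis.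
From mathcomp Require Import zify lra.

Set Implicit Arguments.
Unset Strict Implicit.
Unset Printing Implicit Defensive.

Import Order.TTheory GRing.Theory Num.Theory.
Import numFieldNormedType.Exports.

Local Open Scope classical_set_scope.
Local Open Scope ring_scope.

(** * Integer vectors in a subspace and the counting induction *)

Lemma mul_pid_mxE (A : pzSemiRingType) (m n k : nat) (M : 'M[A]_(m, n)) i j :
  (M *m (pid_mx k : 'M[A]_n)) i j = M i j *+ (j < k)%N.
Proof.
rewrite mxE (bigD1 j)//= big1 => [|l lj].
  by rewrite mxE eqxx/= addr0 mulr_natr.
by rewrite mxE (negbTE lj : (l == j :> nat) = false) mulr0.
Qed.

(** Membership in a coordinate subspace becomes an equation, which can be transferred between
    integer vectors and their images in the field. *)
Lemma sub_pid_mxP (F : fieldType) (k n : nat) (y : 'rV[F]_n) : (k <= n)%N ->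
  (y <= (pid_mx k : 'M[F]_(k, n)))%MS <-> y *m (pid_mx k : 'M[F]_n) = y.
Proof.
move=> lekn; split=> [/submxP[c ->]|<-].
  by rewrite -mulmxA pid_mx_id.
by rewrite -(@pid_mx_id _ n k n k (leqnn k)) mulmxA submxMl.
Qed.

Lemma rmorph_unitmx (A B : comUnitRingType) (f : {rmorphism A -> B}) (n : nat)
    (M : 'M[A]_n) :
  M \in unitmx -> map_mx f M \in unitmx.
Proof. by rewrite !unitmxE det_map_mx => /(rmorph_unit f). Qed.

(* The rows of A form a maximal independent family of integer vectors in V;
   the right factor of its Smith normal form straightens V. *)
Lemma saturated_unimodular (F : numFieldType) (n : nat) (V : 'M[F]_n) :
  exists k, exists2 U : 'M[int]_n, U \in unitmx &
    (k <= \rank V)%N /\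
    forall z : 'rV[int]_n, (map_mx intr z <= V)%MS <->
      z *m U *m (pid_mx k : 'M[int]_n) = z *m U.
Proof.
pose P k := `[< exists A : 'M[int]_(k, n),
  row_free (map_mx intr A : 'M[F]_(k, n)) /\ (map_mx intr A <= V)%MS >].
have P0 : exists k, P k.
  exists 0; apply/asboolP; exists 0; split; last by rewrite map_mx0 sub0mx.
  by rewrite /row_free -leqn0 rank_leq_row.
have Pub k : P k -> (k <= \rank V)%N.
  by move=> /asboolP[A [/eqP rkA /mxrankS]]; rewrite rkA.
case: (ex_maxnP P0 Pub) => k Pk kmax.
have kV := Pub k Pk.
have kn : (k <= n)%N by apply: leq_trans kV (rank_leq_row _).
case/asboolP: Pk => A [Afree AV].
(* By maximality of [k], the span of the rows of [A] over [F] contains every integer vector of [V],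
   although it may be smaller than [V]. *)
have VA (z : 'rV[int]_n) : (map_mx intr z <= V)%MS ->
    (map_mx intr z <= (map_mx intr A : 'M[F]_(k, n)))%MS.
  move=> zV; apply: contraT => zA.
  suff /kmax : P (k + 1)%N by rewrite addn1 ltnn.
  apply/asboolP; exists (col_mx A z); rewrite map_col_mx; split; last first.
    by rewrite col_mx_sub AV.
  have z0 : \rank (map_mx intr z : 'rV[F]_n) = 1.
    by rewrite rank_rV; case: eqP zA => // ->; rewrite sub0mx.
  have cap0 : (map_mx intr A :&: (map_mx intr z : 'rV[F]_n) = 0)%MS.
    apply/eqP; rewrite -mxrank_eq0; apply: contraT; rewrite -lt0n => capgt0.
    have : (map_mx intr z <= map_mx intr A :&: (map_mx intr z : 'rV[F]_n))%MS.
      rewrite -(geq_leqif (mxrank_leqif_sup (capmxSr _ _))) z0.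
      exact: capgt0.
    by rewrite sub_capmx (negbTE zA).
  rewrite /row_free -addsmxE (mxrank_disjoint_sum cap0) z0.
  by rewrite (eqP Afree).
have [L Lu [W Wu [d _ defA]]] := int_Smith_normal_form A.
pose D := diag_mx (\row_(i < k) (d`_i)%:~R : 'rV[F]_k).
have defD : map_mx intr (\matrix_(i < k, j < n) (d`_i *+ (i == j :> nat)))
    = D *m (pid_mx k : 'M[F]_(k, n)).
  apply/matrixP=> i j; rewrite mul_diag_mx !mxE rmorphMn/=.
  by rewrite ltn_ord andbT mulr_natr.
have LuF : (map_mx intr L : 'M[F]_k) \in unitmx by apply: rmorph_unitmx.
have WuF : (map_mx intr W : 'M[F]_n) \in unitmx by apply: rmorph_unitmx.
have defAF : map_mx intr A =
    map_mx intr L *m (D *m (pid_mx k : 'M[F]_(k, n))) *m map_mx intr W :> 'M[F]_(k, n).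
  by rewrite [A]defA !map_mxM -defD.
(* Since [A] has rank [k], no elementary divisor vanishes. Over [F] the factors [L] and [D] thus
   leave the row space unchanged, and [invmx W] carries it to the first [k] coordinates. *)
have Du : D \in unitmx.
  rewrite -row_full_unit -col_leq_rank.
  move: Afree; rewrite /row_free defAF mxrankMfree ?row_free_unit// => /eqP rk.
  rewrite -[X in (X <= _)%N]rk.
  by apply: leq_trans (mxrankM_maxr _ _) (mxrankM_maxl _ _).
have eqA (z : 'rV[F]_n) : (z <= (map_mx intr A : 'M[F]_(k, n)))%MS =
    (z *m invmx (map_mx intr W) <= (pid_mx k : 'M[F]_(k, n)))%MS.
  rewrite -{1}(mulmxKV WuF z) defAF submxMfree ?row_free_unit//.
  rewrite (eqmxMfull _ (A := map_mx intr L)) ?row_full_unit//.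
  by rewrite (eqmxMfull _ (A := D)) ?row_full_unit.
have intrI : injective (map_mx intr : 'rV[int]_n -> 'rV[F]_n).
  by move=> x y /rowP xy; apply/rowP=> j; have := xy j; rewrite !mxE => /intr_inj.
have map_invW : map_mx intr (invmx W) = invmx (map_mx intr W) :> 'M[F]_n.
  by apply: (can_inj (mulmxK WuF)); rewrite -map_mxM !mulVmx// map_mx1.
exists k, (invmx W); rewrite ?unitmx_inv//; split=> // z.
have -> : (map_mx intr z <= V)%MS <->
    (map_mx intr z <= (map_mx intr A : 'M[F]_(k, n)))%MS.
  by split=> [/VA //|/submx_trans]; apply.
rewrite eqA; apply: (iff_trans (sub_pid_mxP _ kn)).
rewrite -map_invW -map_mxM -(map_pid_mx (intr : int -> F)) -map_mxM.
by split=> [/intrI|->].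
Qed.

(* The induction passes to a subspace V i with a i minimal; its codimension may
   exceed i + 1, which is harmless since every other a j is at least a i. *)
Lemma lattice_points_bound (F : numFieldType) (n : nat) (X : seq 'rV[int]_n)
    (a : nat -> nat) (V : nat -> 'M[F]_n) :
  uniq X ->
  (forall i, (i < n)%N -> [/\ (0 < a i)%N, (\rank (V i) <= n - i.+1)%N &
     forall x y w, x \in X -> y \in X ->
       (map_mx intr (x - y - w *+ a i) <= V i)%MS ->
       (map_mx intr (x - y) <= V i)%MS]) ->
  (size X <= \prod_(0 <= i < n) a i)%N.
Proof.
elim/ltn_ind: n => -[_|n IHn] in X a V *.
  rewrite big_geq// => uX _; apply: (@uniq_leq_size _ X [:: 0]) => // x _.
  by rewrite inE thinmx0.
move=> uX hyp.
have [i0 _ i0min] := arg_minnP (fun i : 'I_n.+1 => a i) (isT : xpredT ord0).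
have [a0 rV0 hV0] := hyp i0 (ltn_ord i0).
have [k [U Uu [kV VU]]] := saturated_unimodular (V i0).
(* Each [V i] has positive codimension, so the dimension really drops. *)
have kn : (k < n.+1)%N by lia.
pose b := (a i0).-1; have ab : a i0 = b.+1 by rewrite prednK.
(* In the coordinates given by [U], the first [k] describe the integer vectors of [V i0]; [f]
   records the remaining ones modulo [a i0]. *)
pose f (x : 'rV[int]_n.+1) : {ffun 'I_(n.+1 - k) -> 'I_b.+1} :=
  [ffun j => inord `|((x *m U) ord0 (inord (k + nat_of_ord j)) %% (a i0)%:Z)%Z|%N].
have fP x y : x \in X -> y \in X -> f x = f y ->
    (x - y) *m U *m (pid_mx k : 'M[int]_n.+1) = (x - y) *m U.
  move=> xX yX fxy; apply/VU.
  (* For equal residues the last coordinates of [x - y] are exactly [a i0] times those of [w], so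
     subtracting this multiple leaves an integer vector of [V i0]. *)
  pose w : 'rV[int]_n.+1 :=
    \row_i (if (i < k)%N then 0 else (((x - y) *m U) ord0 i %/ (a i0)%:Z)%Z).
  apply: (hV0 _ _ (w *m invmx U)) => //; apply/VU.
  rewrite mulmxBl -scaler_nat -scalemxAl mulmxKV// scaler_nat.
  apply/rowP=> j; rewrite mul_pid_mxE; case: ltnP => [|kj]; first by rewrite mulr1n.
  rewrite mulr0n mxE [X in _ + X]mxE mulmxnE [w _ _]mxE ltnNge kj/=.
  suff dv : ((a i0)%:Z %| ((x - y) *m U) ord0 j)%Z.
    by rewrite -[_ *+ _]mulr_natr natz divzK// subrr.
  have jn := ltn_ord j; have jk : (j - k < n.+1 - k)%N by lia.
  have /(congr1 val) := congr1 (fun g : {ffun _ -> _} => g (Ordinal jk)) fxy.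
  have an0 : (a i0)%:Z != 0 by lia.
  have lt_m m : (`|(m %% (a i0)%:Z)%Z| < b.+1)%N.
    by have := ltz_mod m an0; have := modz_ge0 m an0; lia.
  rewrite !ffunE /= !inordK// subnKC// inord_val => /eqP/eqP e.
  have {}e : ((x *m U) ord0 j %% (a i0)%:Z)%Z = ((y *m U) ord0 j %% (a i0)%:Z)%Z.
    by have := modz_ge0 ((x *m U) ord0 j) an0;
       have := modz_ge0 ((y *m U) ord0 j) an0; lia.
  by rewrite mulmxBl !mxE -eqz_mod_dvd; apply/eqP; move: e; rewrite !mxE.
have fib c : (count (fun x => f x == c) X <=
    \prod_(0 <= i < k) a (i + (n.+1 - k))%N)%N.
  rewrite -size_filter; set Y := [seq x <- X | f x == c].
  have uY : uniq Y by rewrite filter_uniq.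
  have [->//|] := eqVneq Y [::]; rewrite -size_eq0 -lt0n => Ypos.
  (* With [y0] as base point, [p] reads off the first [k] straightened coordinates and [E] embeds
     them back, which identifies the fibre with integer vectors of length [k]. *)
  pose y0 := nth 0 Y 0; have y0Y : y0 \in Y by apply: mem_nth.
  pose p (x : 'rV[int]_n.+1) := (x - y0) *m U *m (pid_mx k : 'M[int]_(n.+1, k)).
  pose E := (pid_mx k : 'M[int]_(k, n.+1)) *m invmx U.
  have YX y : y \in Y -> y \in X by rewrite mem_filter => /andP[].
  have pK y : y \in Y -> p y *m E = y - y0.
    move=> yY; rewrite /p /E mulmxA -[_ *m pid_mx k *m pid_mx k]mulmxA.
    rewrite pid_mx_id ?(ltnW kn)// fP ?YX//; first by rewrite mulmxK.
    by move: yY y0Y; rewrite !mem_filter => /andP[/eqP -> _] /andP[/eqP -> _].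
  have -> : size Y = size (map p Y) by rewrite size_map.
  have Efree : row_free (map_mx intr E : 'M[F]_(k, n.+1)).
    rewrite map_mxM map_pid_mx /row_free mxrankMfree.
      by rewrite rank_pid_mx ?(ltnW kn).
    by rewrite row_free_unit rmorph_unitmx// unitmx_inv.
  (* This kernel is the preimage of [V (i + (n.+1 - k))] under [E]. The shift turns the old rank
     bound into exactly [k - i.+1], as the induction hypothesis requires. *)
  pose V' i : 'M[F]_k :=
    kermx (map_mx intr E *m cokermx (V (i + (n.+1 - k))%N)).
  have V'P i (u : 'rV[int]_k) : (map_mx intr u <= V' i)%MS =
      (map_mx intr (u *m E) <= V (i + (n.+1 - k))%N)%MS.
    by rewrite map_mxM [RHS]submxE -mulmxA; apply: (sameP sub_kermxP); exact: eqP.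
  apply: (IHn k kn _ (fun i => a (i + (n.+1 - k))%N) V').
    rewrite map_inj_in_uniq// => x y /pK ex /pK ey pxy.
    by apply: (@addIr _ (- y0)); rewrite -ex -ey pxy.
  move=> i ik; have [] := hyp (i + (n.+1 - k))%N; first by lia.
  move=> api rki hi; split=> //.
    rewrite -(mxrankMfree _ Efree).
    have /mxrankS : (V' i *m map_mx intr E <= V (i + (n.+1 - k))%N)%MS.
      by rewrite submxE -mulmxA mulmx_ker.
    by move=> /leq_trans; apply; apply: leq_trans rki _; lia.
  move=> _ _ w /mapP[x xY ->] /mapP[y yY ->]; rewrite !V'P.
  rewrite -scaler_nat !mulmxBl -scalemxAl !pK// scaler_nat.
  have -> : x - y0 - (y - y0) = x - y by rewrite opprB addrA subrK.
  by apply: hi; apply: YX.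
have -> : size X = (\sum_c count (fun x => f x == c) X)%N.
  rewrite -sum1_size (partition_big f xpredT)//=.
  by apply: eq_bigr => c _; rewrite sum1_count.
(* There are at most [a i0 ^ (n.+1 - k)] fibres, and minimality of [a i0] bounds this power by the
   product of the first [n.+1 - k] factors. *)
apply: leq_trans (leq_sum _ (fun c _ => fib c)) _.
rewrite sum_nat_const card_ffun !card_ord -ab.
rewrite [leqRHS](@big_cat_nat _ _ _ (n.+1 - k)) ?leq_subr//=.
have -> : (\prod_(n.+1 - k <= i < n.+1) a i =
    \prod_(0 <= i < k) a (i + (n.+1 - k)))%N.
  by rewrite -{1}[(n.+1 - k)%N]add0n big_addn subKn ?(ltnW kn).
apply: leq_mul => //; rewrite -{1}[(n.+1 - k)%N]subn0 -prod_nat_const_nat !big_mkord.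
apply: leq_prod => i _; have ilt : (i < n.+1)%N by have := ltn_ord i; lia.
exact: (i0min (Ordinal ilt)).
Qed.

(** * Dictionary between subspaces of column vectors and row spaces of matrices *)

Lemma memv_span_rows (F : fieldType) (k n : nat) (A : 'M[F]_(k, n)) (v : 'cV_n) :
  (v \in <<[tuple (row i A)^T | i < k]>>%VS) = (v^T <= A)%MS.
Proof.
apply/idP/idP => [/coord_span ->|/submxP[c defv]].
  rewrite linear_sum; apply: summx_sub => i _.
  by rewrite -tnth_nth tnth_mktuple linearZ/= trmxK scalemx_sub ?row_sub.
rewrite -[v]trmxK defv mulmx_sum_row linear_sum; apply: memv_suml => i _.
rewrite linearZ memvZ// memv_span//; apply/tnthP; exists i.
by rewrite tnth_mktuple.
Qed.

Lemma free_span_rows (F : fieldType) (k n : nat) (A : 'M[F]_(k, n)) :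
  free [tuple (row i A)^T | i < k] = row_free A.
Proof.
apply/freeP/idP => [X0|Afree].
  apply: inj_row_free => c cA0; apply/rowP=> i; rewrite mxE.
  apply: (X0 (c ord0)); apply: trmx_inj; rewrite trmx0 -[RHS]cA0 mulmx_sum_row.
  rewrite linear_sum; apply: eq_bigr => j _.
  by rewrite -tnth_nth tnth_mktuple linearZ/= trmxK.
move=> c c0 i; pose d := \row_j c j.
suff : d = 0 by move/rowP/(_ i); rewrite !mxE.
apply: (row_free_inj Afree); rewrite mul0mx; apply: trmx_inj.
rewrite trmx0 -[RHS]c0 mulmx_sum_row linear_sum; apply: eq_bigr => j _.
by rewrite -tnth_nth tnth_mktuple linearZ/= mxE.
Qed.

Lemma vspace_of_rows (F : fieldType) (k n : nat) (A : 'M[F]_(k, n)) :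
  row_free A ->
  exists2 L : {vspace 'cV[F]_n}, \dim L = k &
    forall v, (v \in L) = (v^T <= A)%MS.
Proof.
move=> Afree; exists <<[tuple (row i A)^T | i < k]>>%VS; last first.
  exact: memv_span_rows.
by rewrite -free_span_rows in Afree; rewrite (eqP Afree) size_tuple.
Qed.

Lemma rows_of_vspace (F : fieldType) (n : nat) (L : {vspace 'cV[F]_n}) :
  exists2 A : 'M[F]_n, \rank A = \dim L &
    forall v, (v \in L) = (v^T <= A)%MS.
Proof.
pose A : 'M[F]_(\dim L, n) := \matrix_i (tnth (vbasis L) i)^T.
have defX : vbasis L = [tuple (row i A)^T | i < \dim L].
  by apply: eq_from_tnth => i; rewrite tnth_mktuple rowK trmxK.
exists <<A>>%MS => [|v]; rewrite genmxE.
  apply/eqP; move: (basis_free (vbasisP L)).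
  by rewrite defX free_span_rows.
by rewrite -memv_span_rows -defX (span_basis (vbasisP L)).
Qed.

(** * Bounds for the packing minima *)

Lemma le_mx_norm (R : realDomainType) (m n : nat) (x : 'M[R]_(m, n)) i j :
  `|x i j| <= `|x|.
Proof.
rewrite [leRHS]/Num.norm/= mx_normrE.
exact: (le_bigmax _ (fun ij : 'I_m * 'I_n => `|x ij.1 ij.2|) (i, j)).
Qed.

Section packing_min.
Variables (R : realType) (n : nat).
Implicit Types (K : set 'cV[R]_n) (B : 'M[R]_n).

(** Since [K] has interior points, a large multiple of its difference body contains all columns of
    [B]. Equality of the two sets would then put a basis in [L], whose dimension is less than [n].
    Hence the infimum is not the default value on the empty set. *)
Lemma packing_min_witness K B (i : nat) :
  (0 < i <= n)%N -> K° !=set0 -> B \in unitmx ->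
  exists rho : R, 0 < rho /\
    forall L : {vspace 'cV[R]_n}, \dim L = (n - i)%N ->
      thickening K rho L `&` lattice_of B <> [set` L] `&` lattice_of B.
Proof.
move=> ilen [x0 /nbhs_ballP[e /= e0 ballK]] Bu.
have Kx0 : K x0 by apply: ballK; exact: ballxx.
pose d := e / 2 / (`|B| + 1).
have B1 : 0 < `|B| + 1 by rewrite ltr_wpDl.
have d0 : 0 < d by rewrite !divr_gt0.
exists d^-1; split; first by rewrite invr_gt0.
move=> L dimL eqL.
have colL j : col j B \in L.
  have : ([set` L] `&` lattice_of B) (col j B).
    rewrite -eqL; split; last first.
      by exists (delta_mx j 0) => //; rewrite map_delta_mx colE.
    exists (d *: col j B); last first.
      by exists 0; rewrite /= ?mem0v// addr0 scalerA mulVf ?gt_eqF// scale1r.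
    exists (x0 + d *: col j B); last by exists x0 => //; rewrite addrC addKr.
    apply: ballK; split=> // k l; rewrite -ball_normE/= !mxE opprD addrA subrr sub0r.
    rewrite normrN normrM (gtr0_norm d0).
    have le1 : `|B k j| <= `|B| + 1 by rewrite ler_wpDr// le_mx_norm.
    apply: le_lt_trans (ler_wpM2l (ltW d0) le1) _.
    by rewrite divfK ?gt_eqF// ltr_pdivrMr// ltr_pMr// ltr1n.
  by case.
suff : L = fullv.
  move=> Lf; move: dimL; rewrite Lf dimvf /dim /= muln1; lia.
apply/vspaceP=> v; rewrite memvf.
have -> : v = B *m (invmx B *m v) by rewrite mulKVmx.
have -> (u : 'cV[R]_n) : B *m u = \sum_j u j 0 *: col j B.
  apply/colP=> k; rewrite summxE mxE; apply: eq_bigr => j _.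
  by rewrite !mxE mulrC.
by rewrite memv_suml// => j _; rewrite memvZ.
Qed.

(** For [rho < C^-1] the span [L] of the first [n - i] columns of [B] violates the defining
    condition: a lattice point of the thickening has its last [i] coordinates in the basis [B]
    integral and of absolute value below 1, hence zero. *)
Lemma packing_min_ge K B (C : R) (i : nat) :
  (0 < i <= n)%N -> K° !=set0 -> B \in unitmx -> 0 < C ->
  (forall x y, K x -> K y -> forall j, `|(invmx B *m (x - y)) j 0| <= C) ->
  C^-1 <= packing_min K (lattice_of B) i.
Proof.
move=> ilen K0 Bu C0 KC; apply: lb_le_inf.
  exact: packing_min_witness.
move=> rho [rho0 hrho]; rewrite leNgt; apply/negP => rhoC.
pose A := (pid_mx (n - i) : 'M[R]_(n - i, n)) *m B^T.
have BTu : B^T \in unitmx by rewrite unitmx_tr.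
have lein : (n - i <= n)%N by rewrite leq_subr.
have Afree : row_free A.
  by rewrite /row_free mxrankMfree ?row_free_unit// rank_pid_mx.
have [L dimL LP] := vspace_of_rows Afree.
have LP' v : v \in L <->
    (invmx B *m v)^T *m (pid_mx (n - i) : 'M[R]_n) = (invmx B *m v)^T.
  rewrite LP trmx_mul trmx_inv; apply: iff_trans (sub_pid_mxP _ lein).
  by rewrite -{1}(mulmxKV BTu v^T) submxMfree ?row_free_unit.
apply: (hrho L dimL); apply/seteqP; split=> w [].
  move=> [_ [x Kx [y Ky <-]] [l Ll <-]] [z _ defz].
  split; last by exists z.
  apply/LP'; rewrite -defz mulKmx//; apply/rowP=> j.
  rewrite mul_pid_mxE; case: ltnP => // jn; rewrite mulr0n !mxE.
  have l0 : (invmx B *m l) j 0 = 0.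
    have /LP'/rowP/(_ j) := Ll.
    by rewrite mul_pid_mxE ltnNge jn mulr0n mxE => <-.
  have : `|(map_mx intr z : 'cV[R]_n) j 0| < 1.
    rewrite -(mulKmx Bu (map_mx intr z)) defz mulmxDr -scalemxAr mxE l0 addr0.
    rewrite mxE normrM (gtr0_norm rho0).
    apply: le_lt_trans (ler_wpM2l (ltW rho0) (KC _ _ Kx Ky j)) _.
    by rewrite -ltr_pdivlMr// div1r.
  rewrite mxE -intr_norm (_ : 1 = 1%:~R :> R)// ltr_int => z1.
  by have -> : z j 0 = 0 by lia.
move=> Lw Bw; split=> //; have [x0 /interior_subset Kx0] := K0.
exists (x0 - x0); first by exists x0 => //; exists x0.
by exists w; rewrite //= subrr scaler0 add0r.
Qed.

Lemma packing_min_gt0 K B (i : nat) :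
  (0 < i <= n)%N -> K° !=set0 -> compact K -> B \in unitmx ->
  0 < packing_min K (lattice_of B) i.
Proof.
move=> ilen K0 /compact_bounded[M [_ Mbound]] Bu.
pose M' := `|M| + 1.
have KM x : K x -> `|x| <= M'.
  by apply: Mbound; rewrite (le_lt_trans (ler_norm _))// ltrDl.
(* Entrywise bound for [invmx B *m (x - y)], where [x - y] has norm at most [M' + M']; adding 1
   makes [C] positive. *)
pose C := \sum_(k < n) `|invmx B| * (M' + M') + 1.
have M'0 : 0 < M' by rewrite ltr_wpDl.
have C0 : 0 < C.
  by rewrite ltr_wpDl// sumr_ge0// => k _; rewrite mulr_ge0// addr_ge0// ltW.
apply: lt_le_trans (packing_min_ge ilen K0 Bu C0 _); first by rewrite invr_gt0.
move=> x y Kx Ky j; rewrite mxE; apply: (le_trans (ler_norm_sum _ _ _)).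
apply: le_trans (_ : _ <= \sum_(k < n) `|invmx B| * (M' + M')) _; last first.
  by rewrite lerDl.
apply: ler_sum => k _; rewrite normrM ler_pM ?le_mx_norm//.
apply: (le_trans (le_mx_norm _ _ _)); apply: (le_trans (ler_normB _ _)).
by rewrite lerD ?KM.
Qed.

Lemma floor_packing_gt0 K B (i : nat) :
  (0 < i <= n)%N -> K° !=set0 -> compact K -> B \in unitmx ->
  0 < Num.floor (1 / packing_min K (lattice_of B) i + 1).
Proof.
move=> ilen K0 Kc Bu.
have := packing_min_gt0 ilen K0 Kc Bu => r0.
by rewrite gtz0_ge1 floor_ge_int lerDr divr_ge0// ltW.
Qed.

(* Writing x - y = a w + l with l \in L gives w \in a^-1 K_c + L. *)
Lemma packing_subspace K B (i : nat) (a : nat) :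
  (0 < a)%N -> a%:R^-1 < packing_min K (lattice_of B) i ->
  exists2 L : {vspace 'cV[R]_n}, \dim L = (n - i)%N &
    forall x y w, K x -> K y -> lattice_of B w ->
      x - y - w *+ a \in L -> x - y \in L.
Proof.
move=> a0 lta.
have a0R : 0 < a%:R :> R by rewrite ltr0n.
have : ~ (0 < (a%:R^-1 : R) /\ forall L : {vspace 'cV[R]_n}, \dim L = (n - i)%N ->
      thickening K a%:R^-1 L `&` lattice_of B <> [set` L] `&` lattice_of B).
  move=> h; move: lta; rewrite ltNge => /negP; apply.
  by apply: ge_inf => //; exists 0 => r [/ltW].
move=> /not_andP[|/existsNP[L /not_implyP[dimL /contrapT eqL]]].
  by rewrite invr_gt0 a0R.
exists L => // x y w Kx Ky Bw xyw.
suff wL : w \in L.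
  by rewrite -(subrK (w *+ a) (x - y)); apply: rpredD => //; apply: rpredMn.
have : ([set` L] `&` lattice_of B) w.
  rewrite -eqL; split=> //; exists (x - y); first by exists x => //; exists y.
  exists (- (a%:R^-1 *: (x - y - w *+ a))); first by rewrite /= memvN memvZ.
  rewrite [_ *: (_ - w *+ a)]scalerBr -[w *+ a]scaler_nat scalerA mulVf ?gt_eqF// scale1r opprB.
  by rewrite addrC subrK.
by case.
Qed.

(** * From the counting bound to lattice points of a body *)

(** Stated for duplicate-free sequences so that finiteness of the set of lattice points can be
    deduced from it. *)
Lemma size_lattice_points_le K B (s : seq 'cV[R]_n) :
  K° !=set0 -> compact K -> B \in unitmx -> uniq s ->
  {in s, forall x, (K `&` lattice_of B) x} ->
  (size s)%:Z <=
    \prod_(1 <= i < n.+1) Num.floor (1 / packing_min K (lattice_of B) i + 1).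
Proof.
move=> K0 Kc Bu us sK.
(* The counting lemma indexes from 0, so [a i] belongs to the packing minimum of index [i.+1]. *)
pose a i := `|Num.floor (1 / packing_min K (lattice_of B) i.+1 + 1)|%N.
have aE i : (i < n)%N ->
    (a i)%:Z = Num.floor (1 / packing_min K (lattice_of B) i.+1 + 1).
  by move=> ilt; rewrite /a gez0_abs// ltW// floor_packing_gt0.
have a0 i : (i < n)%N -> (0 < a i)%N.
  by move=> ilt; rewrite -ltz_nat aE// floor_packing_gt0.
rewrite big_add1/= (eq_big_nat _ _ (F2 := fun i => (a i)%:Z)); last first.
  by move=> i /andP[_ /aE ->].
rewrite -(big_morph Posz PoszM (erefl _)) lez_nat.
(* With [t] the inverse of the packing minimum, the floor of [t + 1] exceeds [t]; inverting gives
   the claim. *)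
have ltinv i : (i < n)%N -> (a i)%:R^-1 < packing_min K (lattice_of B) i.+1.
  move=> ilt; have r0 : 0 < packing_min K (lattice_of B) i.+1.
    exact: packing_min_gt0.
  rewrite invf_plt ?posrE ?ltr0n ?a0//.
  have := floorD1_gt (1 / packing_min K (lattice_of B) i.+1 + 1).
  by rewrite -aE// intrD ltrD2r div1r.
(* Coordinates in the basis [B]; on lattice points they are integers, so the floor is exact. *)
pose z (x : 'cV[R]_n) : 'cV[int]_n := map_mx Num.floor (invmx B *m x).
have zK x : x \in s -> B *m map_mx intr (z x) = x.
  move=> /sK[_ [u _ <-]]; rewrite /z mulKmx//; congr (_ *m _).
  by apply/matrixP=> k l; rewrite !mxE intrKfloor.
have VP i : exists V : 'M[R]_n, (i < n)%N -> (\rank V <= n - i.+1)%N /\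
   forall x y w, x \in [seq (z x)^T | x <- s] -> y \in [seq (z x)^T | x <- s] ->
       (map_mx intr (x - y - w *+ a i) <= V)%MS ->
       (map_mx intr (x - y) <= V)%MS.
  have [ilt|ige] := ltnP i n; last by exists 0.
  have [L dimL hL] := packing_subspace (a0 _ ilt) (ltinv _ ilt).
  have [A rkA AP] := rows_of_vspace L.
  have BTu : B^T \in unitmx by rewrite unitmx_tr.
  (* The subspace [L] rewritten in lattice coordinates, as a row space. *)
  exists (A *m invmx B^T) => _; split.
    by rewrite mxrankMfree ?rkA ?dimL// row_free_unit unitmx_inv.
  have memV (u : 'rV[int]_n) :
      (map_mx intr u <= A *m invmx B^T)%MS = (B *m map_mx intr u^T \in L).
    rewrite AP trmx_mul -map_trmx trmxK -{2}(mulmxKV BTu A).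
    by rewrite submxMfree ?row_free_unit.
  move=> _ _ w /mapP[x xs ->] /mapP[y ys ->]; rewrite !memV.
  rewrite !linearB linearMn/= !trmxK.
  rewrite !map_mxB/= !mulmxBr !zK//.
  have -> : map_mx intr (w^T *+ a i) = map_mx intr w^T *+ a i :> 'cV[R]_n.
    by apply/matrixP=> k l; rewrite !mxE !mulmxnE !mxE rmorphMn.
  rewrite -[_ *+ a i]scaler_nat -scalemxAr scaler_nat.
  apply: hL; [exact: (sK _ xs).1|exact: (sK _ ys).1|by exists w^T].
have [V hV] := choice VP.
rewrite -(size_map (fun x => (z x)^T)).
apply: (lattice_points_bound (V := V)).
  rewrite map_inj_in_uniq// => x y xs ys /trmx_inj e.
  by rewrite -(zK x xs) -(zK y ys) e.
by move=> i ilt; have [] := hV i ilt; split=> //; exact: a0.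
Qed.

(** An infinite set would contain duplicate-free sequences longer than the bound. Finiteness is part
    of the conclusion because [fset_set] is empty on infinite sets. *)
Lemma lattice_points_le K B :
  K° !=set0 -> compact K -> B \in unitmx ->
  finite_set (K `&` lattice_of B) /\
  (#|` fset_set (K `&` lattice_of B)|%fset%:Z <=
      \prod_(1 <= i < n.+1) Num.floor (1 / packing_min K (lattice_of B) i + 1)).
Proof.
move=> K0 Kc Bu.
have KBfin : finite_set (K `&` lattice_of B).
  apply: contrapT; set N := \prod_(1 <= i < n.+1)
    Num.floor (1 / packing_min K (lattice_of B) i + 1).
  move=> /(infinite_set_fset `|N|.+1)[X XK ltX].
  have : (size (enum_fset X))%:Z <= N.
    apply: size_lattice_points_le => //; first exact: fset_uniq.
  by move: ltX; lia.
split=> //; apply: size_lattice_points_le => //; first exact: fset_uniq.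
by move=> x; rewrite in_fset_set// inE.
Qed.

End packing_min.

(** * Equality for the unit cube and the integer lattice *)

Definition unit_cube (R : realType) (n : nat) : set 'cV[R]_n :=
  [set x | forall i, 0 <= x i 0 <= 1].

(** Carries compactness of a product of intervals from row vectors to column vectors. *)
Lemma continuous_trmx (R : numFieldType) (m n : nat) :
  continuous (trmx : 'M[R]_(m, n) -> 'M[R]_(n, m)).
Proof.
move=> M S /= /nbhs_ballP[e e0 eS]; apply/nbhs_ballP; exists e => // N [_ MN].
by apply: eS; split=> // i j; rewrite !mxE; exact: MN.
Qed.

Lemma convex_body_unit_cube (R : realType) (n : nat) :
  convex_body (@unit_cube R n).
Proof.
split.
- have -> : @unit_cube R n =
      trmx @` [set v : 'rV[R]_n | forall i, `[0, 1]%classic (v ord0 i)].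
    apply/seteqP; split=> [x x01|_ [v v01 <-] i]; last first.
      by have := v01 i; rewrite /= in_itv/= mxE.
    by exists x^T; rewrite ?trmxK// => i; rewrite /= in_itv/= mxE x01.
  apply: continuous_compact.
    by apply: continuous_subspaceT; exact: continuous_trmx.
  apply: (@rV_compact R n (fun=> `[0, 1]%classic)) => _.
  exact: segment_compact.
- move=> x y t; rewrite !inE => x01 y01 i.
  have /andP[x0 x1] := x01 i; have /andP[y0 y1] := y01 i.
  have t0 : 0 <= t%:num by []. have t1 : t%:num <= 1 by [].
  rewrite /conv/= !mxE /unstable.onem; apply/andP; split; nra.
- exists (const_mx 2^-1); apply/nbhs_ballP; exists 2^-1 => //= x [_ xb] i.
  have := xb i 0; rewrite -ball_normE/= mxE ltr_norml => /andP[? ?].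
  by apply/andP; split; lra.
Qed.

Lemma unit_cube_lattice_points (R : realType) (n : nat) :
  finite_set (@unit_cube R n `&` lattice_of 1%:M) ->
  (2 ^ n <= #|` fset_set (@unit_cube R n `&` lattice_of 1%:M)|)%N.
Proof.
move=> cube_fin.
pose g (b : {ffun 'I_n -> bool}) : 'cV[R]_n := \col_i (b i)%:R.
have gI : injective g.
  move=> b c /colP gbc; apply/ffunP=> i; have := gbc i; rewrite !mxE.
  by move/eqP; rewrite eqr_nat => /eqP; case: (b i) (c i) => -[].
have <- : size (map g (enum {ffun 'I_n -> bool})) = (2 ^ n)%N.
  by rewrite size_map -cardE card_ffun card_bool card_ord.
apply: uniq_leq_size; first by rewrite map_inj_uniq ?enum_uniq.
move=> _ /mapP[b _ ->]; rewrite in_fset_set// inE; split.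
  by move=> i; rewrite mxE ler0n lern1 leq_b1.
exists (\col_i (b i)%:Z) => //; rewrite mul1mx; apply/matrixP=> i j.
by rewrite !mxE.
Qed.

Lemma unit_cube_sharp (R : realType) (n : nat) :
  #|` fset_set (@unit_cube R n `&` lattice_of 1%:M)|%fset%:Z =
    \prod_(1 <= i < n.+1)
      Num.floor (1 / packing_min (@unit_cube R n) (lattice_of 1%:M) i + 1).
Proof.
have [Kc _ K0] := convex_body_unit_cube R n.
have Bu : (1%:M : 'M[R]_n) \in unitmx by exact: unitmx1.
have [fin le] := lattice_points_le K0 Kc Bu.
apply/eqP; rewrite eq_le le/=.
(* The number [2 ^ n] separates the two sides: the 0-1 vectors give at least that many points, and
   each factor is at most 2. *)
apply: le_trans (_ : _ <= (2 ^ n)%:Z) _; last first.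
  by rewrite lez_nat; apply: unit_cube_lattice_points.
have -> : (2 ^ n)%:Z = \prod_(1 <= i < n.+1) 2.
  by rewrite prodr_const_nat subn1 -natz natrX.
rewrite big_nat [leRHS]big_nat; apply: ler_prod => i ilen.
rewrite ltW ?floor_packing_gt0//=.
(* Coordinates of differences of points of the cube are at most 1 in absolute value, so the lower
   bound applies with [C] equal to 1. *)
have r1 : 1 <= packing_min (@unit_cube R n) (lattice_of 1%:M) i.
  rewrite -[leLHS]invr1; apply: packing_min_ge => // x y x01 y01 j.
  rewrite invmx1 mul1mx !mxE; have /andP[x0 x1] := x01 j.
  have /andP[y0 y1] := y01 j.
  by rewrite ler_norml; apply/andP; split; lra.
rewrite -ltzD1 floor_lt_int//.
have : 1 / packing_min (@unit_cube R n) (lattice_of 1%:M) i <= 1.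
  by rewrite div1r invf_le1 ?(lt_le_trans _ r1).
rewrite (_ : (2 + 1)%:~R = 3 :> R)//; lra.
Qed.

Theorem theorem1p3 (R : realType) (n : nat) :
  (forall K Lam : set 'cV[R]_n, convex_body K -> is_lattice Lam ->
    finite_set (K `&` Lam) /\
    (#|` fset_set (K `&` Lam)|%fset%:Z <=
      \prod_(1 <= i < n.+1) Num.floor (1 / packing_min K Lam i + 1))) /\
  (exists K Lam : set 'cV[R]_n,
    [/\ convex_body K, is_lattice Lam &
      #|` fset_set (K `&` Lam)|%fset%:Z =
        \prod_(1 <= i < n.+1) Num.floor (1 / packing_min K Lam i + 1)]).
Proof.
split=> [K _ [Kc _ K0] [B Bu ->]|]; first exact: lattice_points_le.
exists (@unit_cube R n), (lattice_of 1%:M); split.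
- exact: convex_body_unit_cube.
- by exists 1%:M; rewrite ?unitmx1.
- exact: unit_cube_sharp.
Qed.
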